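(* Let $R$ be a ring. Then $R$ is a Nil$_{\ast}$-Noetherian ring if and only if the formal power series ring $R[[x]]$ in one variable over $R$ is a Nil$_{\ast}$-Noetherian ring.
   Context: All rings are commutative with identity. An ideal $I$ of a ring $R$ is a nil ideal if every element of $I$ is nilpotent. A ring $R$ is Nil$_{\ast}$-Noetherian if every nil ideal of $R$ is finitely generated. *)

(* Defs.v *)
From HB Require Import structures.
From mathcomp Require Import all_boot all_algebra.
From mathcomp Require Import boolp classical_sets functions.

Set Implicit Arguments.
Unset Strict Implicit.
Unset Printing Implicit Defensive.

Import GRing.Theory.
Local Open Scope ring_scope.
Local Open Scope classical_set_scope.

(* A formal power series is its sequence of coefficients. It is wrapped in a
   record because [nat -> R] already carries the pointwise product. *)
Record powerSeries (R : comPzRingType) := PowerSeries { pscoef : nat -> R }.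

HB.instance Definition _ (R : comPzRingType) := [isNew for @pscoef R].
HB.instance Definition _ (R : comPzRingType) :=
  [Choice of powerSeries R by <:].

Section PowerSeriesRing.
Variable R : comPzRingType.
Implicit Types f g h : powerSeries R.

Lemma powerSeriesP f g : (forall n, pscoef f n = pscoef g n) <-> f = g.
Proof.
split=> [|-> //]; case: f => f; case: g => g /= fg.
by congr PowerSeries; apply/funext.
Qed.

Definition ps_zero : powerSeries R := PowerSeries (fun=> 0).
Definition ps_opp f := PowerSeries (fun n => - pscoef f n).
Definition ps_add f g := PowerSeries (fun n => pscoef f n + pscoef g n).

Fact ps_addA : associative ps_add.
Proof. by move=> f g h; apply/powerSeriesP => n /=; rewrite addrA. Qed.

Fact ps_addC : commutative ps_add.
Proof. by move=> f g; apply/powerSeriesP => n /=; rewrite addrC. Qed.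

Fact ps_add0 : left_id ps_zero ps_add.
Proof. by move=> f; apply/powerSeriesP => n /=; rewrite add0r. Qed.

Fact ps_addN : left_inverse ps_zero ps_opp ps_add.
Proof. by move=> f; apply/powerSeriesP => n /=; rewrite addNr. Qed.

HB.instance Definition _ := GRing.isZmodule.Build (powerSeries R)
  ps_addA ps_addC ps_add0 ps_addN.

Definition ps_one : powerSeries R := PowerSeries (fun n => (n == 0)%:R).
Definition ps_mul f g :=
  PowerSeries (fun n => \sum_(i < n.+1) pscoef f i * pscoef g (n - i)).

Fact ps_mulC : commutative ps_mul.
Proof.
move=> f g; apply/powerSeriesP => n /=; rewrite (reindex_inj rev_ord_inj) /=.
by apply: eq_bigr => i _; rewrite (sub_ordK i) mulrC.
Qed.

Fact pscoef_mul f g n :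
  pscoef (ps_mul f g) n = \sum_(i < n.+1) pscoef f i * pscoef g (n - i).
Proof. by []. Qed.

Fact pscoef_mul_rev f g n :
  pscoef (ps_mul f g) n = \sum_(i < n.+1) pscoef f (n - i) * pscoef g i.
Proof. by rewrite ps_mulC; apply: eq_bigr => i _; rewrite mulrC. Qed.

Fact ps_mulA : associative ps_mul.
Proof.
move=> f g h; apply/powerSeriesP => n; rewrite pscoef_mul [RHS]pscoef_mul_rev.
pose coef3 j k := pscoef f j * (pscoef g (n - j - k) * pscoef h k).
transitivity (\sum_(j < n.+1) \sum_(k < n.+1 | (k <= n - j)%N) coef3 j k).
  apply: eq_bigr => j _; rewrite pscoef_mul_rev big_distrr /=.
  by rewrite (big_ord_narrow_leq (leq_subr _ _)).
rewrite (exchange_big_dep predT) //=; apply: eq_bigr => k _.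
transitivity (\sum_(j < n.+1 | (j <= n - k)%N) coef3 j k).
  apply: eq_bigl => j; rewrite -ltnS -(ltnS j) -!subSn ?leq_ord //.
  by rewrite -subn_gt0 -(subn_gt0 j) -!subnDA addnC.
rewrite (big_ord_narrow_leq (leq_subr _ _)) big_distrl /=.
by apply: eq_bigr => j _; rewrite /coef3 -!subnDA addnC mulrA.
Qed.

Fact ps_mul1 : left_id ps_one ps_mul.
Proof.
move=> f; apply/powerSeriesP => n /=; rewrite big_ord_recl subn0 mul1r.
by rewrite big1 ?addr0 // => i _; rewrite mul0r.
Qed.

Fact ps_mulDl : left_distributive ps_mul +%R.
Proof.
move=> f g h; apply/powerSeriesP => n /=; rewrite -big_split.
by apply: eq_bigr => i _; rewrite mulrDl.
Qed.

HB.instance Definition _ := GRing.Zmodule_isComPzRing.Build (powerSeries R)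
  ps_mulA ps_mulC ps_mul1 ps_mulDl.

Lemma pscoef0 n : pscoef (0 : powerSeries R) n = 0.
Proof. by []. Qed.

Lemma pscoefN f n : pscoef (- f) n = - pscoef f n.
Proof. by []. Qed.

Lemma pscoefD f g n : pscoef (f + g) n = pscoef f n + pscoef g n.
Proof. by []. Qed.

Lemma pscoef1 n : pscoef (1 : powerSeries R) n = (n == 0)%:R.
Proof. by []. Qed.

Lemma pscoefM f g n :
  pscoef (f * g) n = \sum_(i < n.+1) pscoef f i * pscoef g (n - i).
Proof. by []. Qed.

End PowerSeriesRing.

(* MathComp's [idealr_closed] only covers proper ideals of nonzero rings. *)
Definition is_ideal (R : comPzRingType) (I : set R) : Prop :=
  [/\ I 0,
      (forall u v, I u -> I v -> I (u + v)) &
      (forall a u, I u -> I (a * u))].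

Definition nilpotent_elt (R : comPzRingType) (x : R) : Prop :=
  exists n : nat, x ^+ n = 0.

Definition nil_ideal (R : comPzRingType) (I : set R) : Prop :=
  is_ideal I /\ forall x, I x -> nilpotent_elt x.

Definition finitely_generated_ideal (R : comPzRingType) (I : set R) : Prop :=
  exists (n : nat) (g : 'I_n -> R),
    I = [set x | exists a : 'I_n -> R, x = \sum_(i < n) a i * g i].

Definition nil_noetherian (R : comPzRingType) : Prop :=
  forall I : set R, nil_ideal I -> finitely_generated_ideal I.

(* Main.v *)
Require Import Defs.
From mathcomp Require Import all_boot all_algebra.
From mathcomp Require Import boolp classical_sets.

(** Both directions compare a nil ideal with ideals of coefficients.

    If [R[[x]]] is Nil_*-Noetherian and [I] is a nil ideal of [R], the
    nilpotent series with constant term in [I] form a nil ideal of [R[[x]]]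
    containing the constants from [I]; the constant terms of a finite
    generating family of it generate [I].

    Conversely, let [J] be a nil ideal of [R[[x]]] and run the proof of
    Hilbert's basis theorem for power series.  With [J_k] the series of [J] of
    order at least [k], let [L_k] be the ideal of the coefficients of [x^k] in
    elements of [J_k].  The proof only ever uses that the [L_k] and their
    increasing union [L] are finitely generated, and here they are because they
    are nil: if [f] has order at least [k] and [f ^+ n = 0], the coefficient of
    [x^(nk)] in [f ^+ n] is the [n]-th power of that of [x^k] in [f].
    Finitely many generators of [L] already come from a single [J_d].  Their
    lifts generate [J_d], the multipliers being power series built one
    coefficient at a time ([fg_order_part_of_all_leading]).  Going back from
    [J_(k+1)] to [J_k] then costs only the lifts of the finitely many
    generators of [L_k] ([fg_order_part_pred]), and [J_0 = J]. *)

Set Implicit Arguments.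
Unset Strict Implicit.
Unset Printing Implicit Defensive.

Import GRing.Theory.
Local Open Scope ring_scope.
Local Open Scope classical_set_scope.

(** * Ideals and nilpotent elements *)

Section Ideals.
Variable R : comPzRingType.
Implicit Types I K : set R.

Lemma ideal_sum I n (u : 'I_n -> R) :
  is_ideal I -> (forall i, I (u i)) -> I (\sum_i u i).
Proof. by case=> I0 ID _ Iu; apply: (big_ind I). Qed.

Lemma idealN I u : is_ideal I -> I u -> I (- u).
Proof. by case=> _ _ IM Iu; rewrite -mulN1r; apply: IM. Qed.

Lemma idealB I u v : is_ideal I -> I u -> I v -> I (u - v).
Proof. by move=> II Iu Iv; case: (II) => _ + _; apply=> //; apply: idealN. Qed.

Lemma ideal_combination I n (a g : 'I_n -> R) :
  is_ideal I -> (forall i, I (g i)) -> I (\sum_i a i * g i).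
Proof.
by move=> II Ig; apply: ideal_sum => // i; case: II => _ _ IM; apply: IM.
Qed.

Lemma finitely_generated_idealP I : is_ideal I ->
  finitely_generated_ideal I <->
  exists (n : nat) (g : 'I_n -> R), (forall i, I (g i)) /\
    forall x, I x -> exists a : 'I_n -> R, x = \sum_(i < n) a i * g i.
Proof.
move=> II; split=> [[n [g Ig]]|[n [g [Ig genI]]]]; exists n, g.
  split=> [i|x]; last by rewrite {1}Ig.
  rewrite Ig; exists (fun j => (j == i)%:R).
  rewrite (bigD1 i) //= eqxx mul1r big1 ?addr0 // => j /negPf->.
  by rewrite mul0r.
apply/seteqP; split=> [x /genI //|x [a ->]]; exact: ideal_combination.
Qed.

(** [K] is finitely generated as soon as [I] and [K / I] are: the family [g]
    generates [K] modulo [I]. *)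
Lemma finitely_generated_extension I K n (g : 'I_n -> R) :
  is_ideal I -> is_ideal K -> I `<=` K -> finitely_generated_ideal I ->
  (forall i, K (g i)) ->
  (forall x, K x -> exists a : 'I_n -> R, I (x - \sum_(i < n) a i * g i)) ->
  finitely_generated_ideal K.
Proof.
move=> II IK subIK /(finitely_generated_idealP II)[m [u [Iu genI]]] Kg genK.
apply/finitely_generated_idealP => //.
exists (n + m)%N.
exists (fun i => match split i with inl j => g j | inr k => u k end).
split=> [i|x /genK[a /genI[b xab]]]; first by case: split => j; auto.
exists (fun i => match split i with inl j => a j | inr k => b k end).
rewrite big_split_ord /= -[LHS](subrK (\sum_(i < n) a i * g i)) xab addrC.
congr (_ + _); apply: eq_bigr => i _.
  by rewrite -[rshift n i]/(unsplit (inr i)) unsplitK.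
by rewrite -[lshift m i]/(unsplit (inl i)) unsplitK.
Qed.

Lemma nilpotent_elt_ideal : is_ideal (@nilpotent_elt R).
Proof.
split=> [|x y [m xm0] [n yn0]|a x [n xn0]]; first by exists 1%N; rewrite expr1.
  exists (m + n)%N; rewrite exprDn big1 // => i _.
  have [le_ni|/ltnW le_in] := leqP n i.
    by rewrite -(subnKC le_ni) [y ^+ _]exprD yn0 mul0r mulr0 mul0rn.
  by rewrite -addnBA // exprD xm0 !mul0r mul0rn.
by exists n; rewrite exprMn xn0 mulr0.
Qed.

End Ideals.

(** * Orders and leading coefficients of power series *)

Section Order.
Variable R : comPzRingType.
Implicit Types (f g h : powerSeries R) (c : R).

Definition order_ge k f := forall i, (i < k)%N -> pscoef f i = 0.

Lemma pscoef_sum n (F : 'I_n -> powerSeries R) k :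
  pscoef (\sum_i F i) k = \sum_i pscoef (F i) k.
Proof.
by apply: (big_morph (fun f => pscoef f k)) => [f g|];
  rewrite ?pscoefD ?pscoef0.
Qed.

Lemma order_geW k l f : (k <= l)%N -> order_ge l f -> order_ge k f.
Proof. by move=> le_kl fl i /leq_trans/(_ le_kl)/fl. Qed.

Lemma order_ge0 f : order_ge 0 f. Proof. by []. Qed.

Lemma order_geS k f : order_ge k f -> pscoef f k = 0 -> order_ge k.+1 f.
Proof.
by move=> fk fk0 i; rewrite ltnS leq_eqVlt => /predU1P[->|/fk].
Qed.

Lemma order_geM k l f g :
  order_ge k f -> order_ge l g -> order_ge (k + l)%N (f * g).
Proof.
move=> fk gl i lt_i; rewrite pscoefM big1 // => j _.
have [/fk->|le_kj] := ltnP j k; first by rewrite mul0r.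
rewrite gl ?mulr0 //.
by rewrite ltn_subLR ?leq_ord // (leq_trans lt_i) // leq_add2r.
Qed.

Lemma pscoefM_leading k l f g : order_ge k f -> order_ge l g ->
  pscoef (f * g) (k + l)%N = pscoef f k * pscoef g l.
Proof.
move=> fk gl; have lt_k : (k < (k + l).+1)%N by rewrite ltnS leq_addr.
rewrite pscoefM (bigD1 (Ordinal lt_k)) //= addKn big1 ?addr0 // => j.
rewrite -val_eqE /= neq_ltn => /orP[/fk->|lt_kj]; first by rewrite mul0r.
by rewrite gl ?mulr0 // ltn_subLR ?leq_ord // ltn_add2r.
Qed.

Lemma order_ge_ideal k : is_ideal (order_ge k).
Proof.
split=> [i _|f g fk gk i lt_ik|f g gk]; first by rewrite pscoef0.
  by rewrite pscoefD fk ?gk ?addr0.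
by rewrite -[k]add0n; apply: order_geM.
Qed.

Lemma order_geX k f n : order_ge k f -> order_ge (n * k)%N (f ^+ n).
Proof.
move=> fk; elim: n => [|n IHn]; first by [].
by rewrite exprS mulSn; apply: order_geM.
Qed.

Lemma pscoefX_leading k f n :
  order_ge k f -> pscoef (f ^+ n) (n * k)%N = pscoef f k ^+ n.
Proof.
move=> fk; elim: n => [|n IHn]; first by rewrite !expr0 pscoef1.
by rewrite !exprS mulSn pscoefM_leading ?IHn //; apply: order_geX.
Qed.

Lemma nilpotent_leading k f :
  order_ge k f -> nilpotent_elt f -> nilpotent_elt (pscoef f k).
Proof. by move=> fk [n fn0]; exists n; rewrite -pscoefX_leading ?fn0. Qed.

Lemma order_ge_eq0 f : (forall k, order_ge k f) -> f = 0.
Proof. by move=> f0; apply/powerSeriesP => n; rewrite (f0 n.+1). Qed.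

Definition monomial c m : powerSeries R :=
  PowerSeries (fun n => if n == m then c else 0).

Lemma order_ge_monomial c m : order_ge m (monomial c m).
Proof. by move=> i lt_im /=; rewrite ltn_eqF. Qed.

Lemma pscoef_monomial c m : pscoef (monomial c m) m = c.
Proof. by rewrite /= eqxx. Qed.

Lemma monomial0X c n : monomial c 0 ^+ n = monomial (c ^+ n) 0.
Proof.
elim: n => [|n IHn].
  by apply/powerSeriesP => -[|k]; rewrite expr0.
rewrite exprS IHn; apply/powerSeriesP => -[|k]; rewrite pscoefM.
  by rewrite big_ord1 /= exprS.
by rewrite big1 // => -[[|i] lt_i] _ /=; rewrite ?mul0r ?mulr0.
Qed.

End Order.

(** * The order filtration of an ideal of power series *)

Section Filtration.
Variables (R : comPzRingType) (J : set (powerSeries R)).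
Hypothesis idJ : is_ideal J.

Definition order_part k : set (powerSeries R) :=
  [set f | J f /\ order_ge k f].

Definition leading k : set R :=
  [set c | exists2 f, order_part k f & pscoef f k = c].

Definition all_leading : set R := [set c | exists k, leading k c].

Lemma order_part_ideal k : is_ideal (order_part k).
Proof.
have [J0 JD JM] := idJ; have [O0 OD OM] := order_ge_ideal R k.
by split=> [|f g [? ?] [? ?]|f g [? ?]]; split; auto.
Qed.

Lemma order_part0 : order_part 0 = J.
Proof. by apply/seteqP; split=> f => [[]|]. Qed.

Lemma order_part_monomialM k m c f :
  order_part k f -> order_part (m + k)%N (monomial c m * f).
Proof.
case=> Jf fk; split; first by case: idJ => _ _; apply.
by apply: order_geM => //; apply: order_ge_monomial.
Qed.

Lemma pscoef_monomialM k m c f :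
  order_part k f -> pscoef (monomial c m * f) (m + k)%N = c * pscoef f k.
Proof.
case=> _ fk; rewrite pscoefM_leading ?pscoef_monomial //.
exact: order_ge_monomial.
Qed.

(** Multiplying by [x^(l-k)] moves a leading coefficient from degree [k] to
    degree [l]. *)
Lemma leading_mono k l : (k <= l)%N -> leading k `<=` leading l.
Proof.
move=> le_kl _ [f fk <-]; exists (monomial 1 (l - k)%N * f).
  by rewrite -[X in order_part X](subnK le_kl); apply: order_part_monomialM.
by rewrite -[X in pscoef _ X](subnK le_kl) pscoef_monomialM ?mul1r.
Qed.

Lemma leading_ideal k : is_ideal (leading k).
Proof.
have [P0 PD _] := order_part_ideal k.
split=> [|_ _ [f Pf <-] [g Pg <-]|c _ [f Pf <-]].
- by exists 0.
- by exists (f + g); first exact: PD.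
- exists (monomial c 0 * f); first exact: (order_part_monomialM 0).
  exact: (pscoef_monomialM 0).
Qed.

Lemma all_leading_ideal : is_ideal all_leading.
Proof.
split=> [|u v [k ku] [l lv]|c u [k ku]].
- by exists 0%N; case: (leading_ideal 0).
- exists (maxn k l); have [_ + _] := leading_ideal (maxn k l); apply.
    exact: leading_mono (leq_maxl _ _) _ ku.
  exact: leading_mono (leq_maxr _ _) _ lv.
- by exists k; have [_ _] := leading_ideal k; apply.
Qed.

Lemma all_leading_bounded n (c : 'I_n -> R) :
  (forall i, all_leading (c i)) -> exists d, forall i, leading d (c i).
Proof.
move=> /choice[k kc]; exists (\max_i k i) => i.
exact: leading_mono (leq_bigmax i) _ (kc i).
Qed.

(** One step of division: a linear relation between leading coefficients
    lets monomial multiples of the [f i] cancel the leading term of [h]. *)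
Lemma cancel_leading k m n (f : 'I_n -> powerSeries R) (r : 'I_n -> R) h :
  (forall i, order_part k (f i)) -> order_part (m + k)%N h ->
  pscoef h (m + k)%N = \sum_i r i * pscoef (f i) k ->
  order_part (m + k).+1%N (h - \sum_i monomial (r i) m * f i).
Proof.
move=> Pf Ph hE.
have [Jd ordd] : order_part (m + k)%N (h - \sum_i monomial (r i) m * f i).
  apply: idealB => //; first exact: order_part_ideal.
  apply: ideal_sum => [|i]; first exact: order_part_ideal.
  exact: order_part_monomialM.
split=> //; apply: order_geS => //.
rewrite pscoefD pscoefN pscoef_sum hE.
by apply/eqP; rewrite subr_eq0; apply/eqP/eq_bigr => i _;
  rewrite pscoef_monomialM.
Qed.

Lemma fg_order_part_pred k :
  finitely_generated_ideal (leading k) ->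
  finitely_generated_ideal (order_part k.+1) ->
  finitely_generated_ideal (order_part k).
Proof.
case/(finitely_generated_idealP (leading_ideal k)) => n [c [Lc genL]] fgS.
have /choice[f Pf] : forall i, exists g, order_part k g /\ pscoef g k = c i.
  by move=> i; have [g ? ?] := Lc i; exists g.
apply: (finitely_generated_extension (I := order_part k.+1) (g := f)) => //.
- exact: order_part_ideal.
- exact: order_part_ideal.
- by move=> g [Jg gk]; split=> //; apply: order_geW gk.
- by move=> i; case: (Pf i).
move=> h Ph; have [r hE] : exists r : 'I_n -> R, pscoef h k = \sum_i r i * c i.
  by apply: genL; exists h.
exists (fun i => monomial (r i) 0); apply: (cancel_leading (m := 0)) => //.
  by move=> i; case: (Pf i).
by rewrite add0n hE; apply: eq_bigr => i _; case: (Pf i) => _ ->.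
Qed.

(** Repeated division converges: if the leading terms of the remainders can be
    cancelled forever, the monomials used in the process are the terms of power
    series multipliers, and the difference between [h] and the resulting
    combination has arbitrarily large order. *)
Lemma order_part_division d n (f : 'I_n -> powerSeries R) h :
  (forall i, order_part d (f i)) ->
  (forall c, all_leading c ->
     exists r : 'I_n -> R, c = \sum_i r i * pscoef (f i) d) ->
  order_part d h ->
  exists a : 'I_n -> powerSeries R, h = \sum_i a i * f i.
Proof.
move=> Pf genL Ph.
have /choice[r rP] : forall mg : nat * powerSeries R, exists r : 'I_n -> R,
    order_part (mg.1 + d)%N mg.2 ->
    order_part (mg.1.+1 + d)%N (mg.2 - \sum_i monomial (r i) mg.1 * f i).
  case=> m g; have [Pg|nPg] := pselect (order_part (m + d)%N g); last first.
    by exists (fun=> 0).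
  have [|r gE] := genL (pscoef g (m + d)%N); first by exists (m + d)%N, g.
  by exists r => _; apply: cancel_leading.
(* [rem m] is the remainder after [m] steps, of order at least [m + d]. *)
pose rem := fix rem m := if m is m'.+1 then
  rem m' - \sum_i monomial (r (m', rem m') i) m' * f i else h.
have remP m : order_part (m + d)%N (rem m).
  by elim: m => [|m IHm] //=; apply: (rP (m, rem m)).
pose a i := PowerSeries (fun m => r (m, rem m) i).
pose a_lt m i := PowerSeries (fun j => if (j < m)%N then pscoef (a i) j else 0).
have remE m : h = rem m + \sum_i a_lt m i * f i.
  elim: m => [|m IHm].
    rewrite big1 ?addr0 // => i _.
    by rewrite (_ : a_lt 0%N i = 0) ?mul0r //; apply/powerSeriesP.
  rewrite {1}IHm /= -addrA; congr (_ + _).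
  rewrite -sumrN -big_split /=; apply: eq_bigr => i _.
  rewrite -mulNr -mulrDl; congr (_ * _); apply/powerSeriesP => j /=.
  rewrite ltnS; case: (ltngtP j m) => [_|_|->] /=.
  - by rewrite oppr0 add0r.
  - by rewrite oppr0 add0r.
  - by rewrite addNr.
exists a; apply/eqP; rewrite -subr_eq0; apply/eqP/order_ge_eq0 => m.
have idm := order_ge_ideal R m.
rewrite {1}(remE m) -addrA -sumrB; have [_ addm _] := idm; apply: addm.
  by have [_] := remP m; apply: order_geW; apply: leq_addr.
apply: ideal_sum => // i.
rewrite -mulrBl -[X in order_ge X]addn0; apply: order_geM; last exact: order_ge0.
by move=> j lt_jm; rewrite pscoefD pscoefN /= lt_jm subrr.
Qed.

Lemma fg_order_part_of_all_leading :
  finitely_generated_ideal all_leading ->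
  exists d, finitely_generated_ideal (order_part d).
Proof.
case/(finitely_generated_idealP all_leading_ideal) => n [c [Lc genL]].
have [d dc] := all_leading_bounded Lc; exists d.
have /choice[f Pf] : forall i, exists g, order_part d g /\ pscoef g d = c i.
  by move=> i; have [g ? ?] := dc i; exists g.
apply/finitely_generated_idealP; first exact: order_part_ideal.
exists n, f; split=> [i|h]; first by case: (Pf i).
apply: order_part_division => [i|b /genL[r ->]]; first by case: (Pf i).
by exists r; apply: eq_bigr => i _; case: (Pf i) => _ ->.
Qed.

Lemma fg_of_leading :
  finitely_generated_ideal all_leading ->
  (forall k, finitely_generated_ideal (leading k)) ->
  finitely_generated_ideal J.
Proof.
move=> /fg_order_part_of_all_leading[d + fgL]; rewrite -order_part0.
by elim: d => // d IHd /(fg_order_part_pred (fgL d)).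
Qed.

End Filtration.

(** * Transfer of the Nil_*-Noetherian property *)

Lemma nil_noetherian_powerSeries (R : comPzRingType) :
  nil_noetherian R -> nil_noetherian (powerSeries R).
Proof.
move=> noethR J [idJ nilJ].
have nilL k c : leading J k c -> nilpotent_elt c.
  by case=> f [Jf fk] <-; apply: nilpotent_leading => //; apply: nilJ.
apply: fg_of_leading => // [|k]; apply: noethR; split.
- exact: all_leading_ideal.
- by move=> c [k /nilL].
- exact: leading_ideal.
- by move=> c /nilL.
Qed.

Lemma nil_noetherian_of_powerSeries (R : comPzRingType) :
  nil_noetherian (powerSeries R) -> nil_noetherian R.
Proof.
move=> noethRx I [idI nilI].
pose J : set (powerSeries R) := [set f | nilpotent_elt f /\ I (pscoef f 0)].
have coef0M (f g : powerSeries R) :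
    pscoef (f * g) 0 = pscoef f 0 * pscoef g 0.
  by rewrite pscoefM big_ord1.
have idJ : is_ideal J.
  have [N0 ND NM] := nilpotent_elt_ideal (powerSeries R).
  have [I0 ID IM] := idI.
  split=> [|f g [? ?] [? ?]|f g [? ?]]; split; rewrite ?coef0M; auto.
  by rewrite pscoefD; apply: ID.
have /(finitely_generated_idealP idJ)[n [g [Jg genJ]]] :
    finitely_generated_ideal J.
  by apply: noethRx; split=> // f [].
apply/finitely_generated_idealP => //.
exists n, (fun i => pscoef (g i) 0); split=> [i|x Ix]; first by case: (Jg i).
have [|a xE] := genJ (monomial x 0).
  split; last by rewrite pscoef_monomial.
  have [m xm0] := nilI x Ix; exists m; rewrite monomial0X xm0.
  by apply/powerSeriesP => j /=; case: ifP.
exists (fun i => pscoef (a i) 0).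
rewrite -[LHS](pscoef_monomial x 0) xE pscoef_sum.
by apply: eq_bigr => i _; rewrite coef0M.
Qed.

Theorem theorem1p12 (R : comPzRingType) :
  nil_noetherian R <-> nil_noetherian (powerSeries R).
Proof.
split; [exact: nil_noetherian_powerSeries|].
exact: nil_noetherian_of_powerSeries.
Qed.
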